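(* Let $\mathcal{H}$ be a real Hilbert space and for $i=1,\dots,k$ let $f_i:\mathcal{H}\to\mathbb{R}$ be locally Lipschitz continuous. Then the Descent Direction Algorithm (defined in the context, with inputs $x\in\mathcal{H}$, $\varepsilon,\delta>0$, $c\in(0,1)$) terminates, so that the sequence $(v_l)_l$ is finite. If $\tilde v$ is the last element of $(v_l)_l$ and $\tilde\xi=R(\tilde v)$, then either $\|\tilde\xi\|_*\le\delta$ or $\tilde v$ is an acceptable descent direction, i.e. $$f_i\Big(x+\frac{\varepsilon}{\|\tilde v\|}\tilde v\Big)\le f_i(x)-c\,\varepsilon\,\|\tilde v\|\quad\text{for all } i=1,\dots,k.$$
   Context: Notation. $\mathcal{H}^*$ is the topological dual, $R:\mathcal{H}\to\mathcal{H}^*$ the Riesz operator, $\langle\xi,\eta\rangle_*=\langle R^{-1}\xi,R^{-1}\eta\rangle$ and $\|\cdot\|_*$ the induced norm. Locally Lipschitz means Lipschitz on a neighbourhood of each point. Generalized directional derivative: $g^\circ(x;v)=\limsup_{y\to x,\,t\searrow0}\frac{g(y+tv)-g(y)}{t}$. Clarke subdifferential: $\partial g(x)=\{\xi\in\mathcal{H}^*:g^\circ(x;v)\ge\xi(v)\ \forall v\in\mathcal{H}\}$. Goldstein $\varepsilon$-subdifferential: $\partial_\varepsilon g(x)=\overline{\operatorname{conv}}\big(\bigcup_{\|y-x\|\le\varepsilon}\partial g(y)\big)$, where $\overline{\operatorname{conv}}$ is the closure of the convex hull $\operatorname{conv}$. Bisection Subroutine (computing a new subderivative). Input: current point $x\in\mathcal{H}$,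 direction $\tilde v=R^{-1}(\tilde\xi)\in\mathcal{H}$, tolerance $\varepsilon>0$, Armijo parameter $c\in(0,1)$; it is applied for an index $i\in\{1,\dots,k\}$ with $f_i(x+\varepsilon\tilde v/\|\tilde v\|)>f_i(x)-c\,\varepsilon\|\tilde v\|$, and uses $h_i:\mathbb{R}\to\mathbb{R}$, $h_i(t)=f_i(x+t\tilde v)-f_i(x)+c\,t\,\|\tilde v\|^2$. Set $a=0$, $b=\varepsilon/\|\tilde v\|$, $t=(a+b)/2$. Then repeat: compute a $\xi'\in\partial f_i(x+t\tilde v)$; if $\langle\tilde\xi,\xi'\rangle_*>-c\|\tilde\xi\|_*^2$, stop; if $h_i(b)>h_i(t)$ set $a=t$, else set $b=t$; set $t=(a+b)/2$. Return the current $\xi'\in\partial f_i(x+t\tilde v)$. Descent Direction Algorithm. Input: current point $x\in\mathcal{H}$, tolerances $\varepsilon,\delta>0$, Armijo parameter $c\in(0,1)$. Compute $\xi_1^i\in\partial_\varepsilon f_i(x)$ for all $i\in\{1,\dots,k\}$ and set $\Xi_1=\{\xi_1^1,\dots,\xi_1^k\}$. For $l=1,2,\dots$: (i) compute $\xi_l=\operatorname{argmin}_{\xi\in-\operatorname{conv}(\Xi_l)}\|\xi\|_*^2$ and set $v_l=R^{-1}(\xi_l)$; (ii) if $\|\xi_l\|_*\le\delta$, return $v_l$; (iii) otherwise find $I_l=\{j\in\{1,\dots,k\}: f_j(x+\varepsilon v_l/\|v_l\|)>f_j(x)-c\,\varepsilon\|v_l\|\}$; (iv) if $I_l=\emptyset$,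 stop; (v) otherwise, for each $j\in I_l$ compute $t_j\in(0,\varepsilon/\|v_l\|]$ and $\zeta_l^j\in\partial f_j(x+t_jv_l)$ with $\langle\xi_l,\zeta_l^j\rangle_*>-c\|\xi_l\|_*^2$ by applying the Bisection Subroutine (at $x$, with $\tilde v=v_l$, $\tilde\xi=\xi_l$, index $i=j$), and set $\Xi_{l+1}=\Xi_l\cup\{\zeta_l^j: j\in I_l\}$.
   Formalization: Termination and the property of the last direction are proved for runs in which every call of the Bisection Subroutine returns; for general locally Lipschitz functions that subroutine can loop forever, so the algorithm as literally described need not terminate. *)

(* Defs.v *)
From HB Require Import structures.
From mathcomp Require Import all_boot all_order all_algebra sesquilinear.
From mathcomp Require Import all_classical all_reals all_analysis ring.

Set Implicit Arguments.
Unset Strict Implicit.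
Unset Printing Implicit Defensive.

Import Order.TTheory GRing.Theory Num.Theory.
Import numFieldNormedType.Exports.

Local Open Scope classical_set_scope.
Local Open Scope ring_scope.

HB.mixin Record CompleteNormedModule_isHilbert (R : realType) H
    & CompleteNormedModule R H := {
  inner : {dot H for (@idfun R)} ;
  inner_normE : forall u : H, inner u u = `|u| ^+ 2
}.

#[short(type="hilbertType")]
HB.structure Definition Hilbert (R : realType) :=
  {H of CompleteNormedModule R H & CompleteNormedModule_isHilbert R H}.

Section TopologicalDual.
Context {R : realType} (H : normedModType R).

Definition dual_pred : {pred H -> R^o} :=
  fun g => `[< linear g /\ continuous g >].

Lemma dual_pred_submod_closed : submod_closed dual_pred.
Proof.
split=> [|a f g /asboolP[fl fc] /asboolP[gl gc]].
  apply/asboolP; split=> [b u v|u]; first by rewrite /= scaler0 addr0.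
  exact: cst_continuous.
apply/asboolP; split=> [b u v|u].
  rewrite !fctE fl gl !scalerDr !scalerA (mulrC a b) -!addrA; congr (_ + _).
  by rewrite addrCA.
by apply: cvgD; [apply: cvgZl_tmp; exact: fc|exact: gc].
Qed.

HB.instance Definition _ := GRing.isSubmodClosed.Build R (H -> R^o) dual_pred
  dual_pred_submod_closed.

Record dual := Dual { dual_fun :> H -> R^o; dualP : dual_fun \in dual_pred }.

HB.instance Definition _ := [isSub for dual_fun].
HB.instance Definition _ := [Choice of dual by <:].
HB.instance Definition _ := [SubChoice_isSubLmodule of dual by <:].

End TopologicalDual.

Section Riesz.
Context {R : realType} {H : hilbertType R}.
Implicit Types (u v : H) (xi eta : dual H).

Lemma innerC u v : inner u v = inner v u.
Proof. by have := @hermitian_subproof _ _ _ _ inner u v; rewrite expr0 mul1r. Qed.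

Lemma inner_linear u : linear (inner u : H -> R^o).
Proof.
move=> a v w; rewrite (raddfD (inner u : {additive H -> R})).
by congr (_ + _); exact: (@linearr_subproof _ _ _ _ _ _ inner).
Qed.

Lemma innerDr u v w : inner u (v + w) = inner u v + inner u w.
Proof. by have := inner_linear u 1 v w; rewrite !scale1r. Qed.

Lemma inner0r u : inner u 0 = 0.
Proof. by apply: (addrI (inner u 0)); rewrite -innerDr !addr0. Qed.

Lemma innerZr a u v : inner u (a *: v) = a * inner u v.
Proof. by have := inner_linear u a v 0; rewrite !addr0 inner0r addr0. Qed.

Lemma inner_CauchySchwarz u v : `|inner u v| <= `|u| * `|v|.
Proof.
have [->|v0] := eqVneq v 0; first by rewrite inner0r !normr0 mulr0.
have nv : 0 < `|v| by rewrite normr_gt0.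
have h a : 0 <= `|u| ^+ 2 + a * inner u v *+ 2 + a ^+ 2 * `|v| ^+ 2.
  suff -> : `|u| ^+ 2 + a * inner u v *+ 2 + a ^+ 2 * `|v| ^+ 2 =
            `|u + a *: v| ^+ 2 by exact: exprn_ge0.
  rewrite -!inner_normE innerDr innerZr (innerC (u + _) u) (innerC (u + _) v).
  rewrite !innerDr !innerZr (innerC v u) mulr2n expr2; ring.
rewrite -ler_sqr ?nnegrE ?mulr_ge0// -normrX ger0_norm ?sqr_ge0//.
have := h (- (inner u v / `|v| ^+ 2)).
have -> : `|u| ^+ 2 + - (inner u v / `|v| ^+ 2) * inner u v *+ 2 +
    (- (inner u v / `|v| ^+ 2)) ^+ 2 * `|v| ^+ 2 =
    (`|u| ^+ 2 * `|v| ^+ 2 - inner u v ^+ 2) / `|v| ^+ 2.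
  by field; rewrite gt_eqF.
by rewrite pmulr_lge0 ?invr_gt0 ?exprn_gt0// subr_ge0 exprMn.
Qed.

Lemma inner_in_dual u : (inner u : H -> R^o) \in @dual_pred R H.
Proof.
apply/asboolP; split; first exact: inner_linear.
pose f : {linear H -> R^o} :=
  HB.pack (inner u : H -> R^o) (GRing.isLinear.Build _ _ _ _ _ (inner_linear u)).
apply: (@bounded_linear_continuous _ _ _ f); apply/linear_boundedP.
near=> r => v; apply: le_trans (inner_CauchySchwarz u v) _.
by apply: ler_wpM2r => //; near: r; exact: nbhs_pinfty_ge.
Unshelve. all: by end_near. Qed.

Definition riesz u : dual H := Dual (inner_in_dual u).

(* [riesz] is bijective (Riesz representation theorem), so the default value 0
   of [xget] is never used. *)
Definition riesz_inv xi : H := xget 0 [set u | riesz u = xi].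

Definition dual_inner xi eta : R := inner (riesz_inv xi) (riesz_inv eta).

Definition dual_norm xi : R := Num.sqrt (dual_inner xi xi).

Definition dual_closure (A : set (dual H)) : set (dual H) :=
  [set xi | forall e, 0 < e -> exists2 eta, A eta & dual_norm (xi - eta) < e].

End Riesz.

Definition convex_hull {R : numDomainType} {E : lmodType R} (A : set E) : set E :=
  smallest (@convex_set R E) A.

Definition locally_lipschitz {R : realType} {H : normedModType R} (g : H -> R) :=
  forall x : H, exists2 U, nbhs x U & [lipschitz (g y : R^o) | y in U].

Section Subdifferentials.
Context {R : realType} {H : hilbertType R}.
Implicit Types (g : H -> R) (x v : H).

Definition generalized_derivative g x v : \bar R :=
  limf_esup (fun p : H * R => ((g (p.1 + p.2 *: v) - g p.1) / p.2)%:E)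
            (filter_prod (nbhs x) 0^'+).

Definition clarke_subdiff g x : set (dual H) :=
  [set xi | forall v, ((xi v)%:E <= generalized_derivative g x v)%E].

Definition goldstein_subdiff (e : R) g x : set (dual H) :=
  dual_closure (convex_hull
    (\bigcup_(y in [set y | `|y - x| <= e]) clarke_subdiff g y)).

End Subdifferentials.

Section BisectionSubroutine.
Context {R : realType} {H : hilbertType R}.
Variables (g : H -> R) (x : H) (xi : dual H) (eps c : R).

Let v := riesz_inv xi.

Definition bisection_fun (t : R) : R := g (x + t *: v) - g x + c * t * `|v| ^+ 2.

Definition bisection_stop (zeta : dual H) : bool :=
  dual_inner xi zeta > - c * dual_norm xi ^+ 2.

(* [bisection_loop a b t zeta]: entered with the interval [a, b], the loop may
   stop after finitely many iterations with the step length t and the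
   subderivative zeta. *)
Inductive bisection_loop (a b : R) : R -> dual H -> Prop :=
| BisectionStop zeta :
    clarke_subdiff g (x + ((a + b) / 2) *: v) zeta ->
    bisection_stop zeta ->
    bisection_loop a b ((a + b) / 2) zeta
| BisectionRight zeta t zeta' :
    clarke_subdiff g (x + ((a + b) / 2) *: v) zeta ->
    ~~ bisection_stop zeta ->
    bisection_fun b > bisection_fun ((a + b) / 2) ->
    bisection_loop ((a + b) / 2) b t zeta' ->
    bisection_loop a b t zeta'
| BisectionLeft zeta t zeta' :
    clarke_subdiff g (x + ((a + b) / 2) *: v) zeta ->
    ~~ bisection_stop zeta ->
    bisection_fun b <= bisection_fun ((a + b) / 2) ->
    bisection_loop a ((a + b) / 2) t zeta' ->
    bisection_loop a b t zeta'.

Definition bisection_returns (t : R) (zeta : dual H) : Prop :=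
  bisection_loop 0 (eps / `|v|) t zeta.

End BisectionSubroutine.

Section DescentDirectionAlgorithm.
Context {R : realType} {H : hilbertType R} {k : nat}.
Variables (f : 'I_k -> H -> R) (x : H) (eps delta c : R).

Definition violated_indices (v : H) : set 'I_k :=
  [set j | f j (x + (eps / `|v|) *: v) > f j x - c * eps * `|v|].

Definition dda_stop (xi : dual H) : Prop :=
  dual_norm xi <= delta \/ violated_indices (riesz_inv xi) = set0.

(* Iterations are numbered from 0, and a sequence is only meaningful at the
   iterations that are performed. *)
Definition dda_reached (xi : nat -> dual H) (l : nat) : Prop :=
  forall m, (m < l)%N -> ~ dda_stop (xi m).

Definition dda_terminates_at (xi : nat -> dual H) (l : nat) : Prop :=
  dda_reached xi l /\ dda_stop (xi l).

Definition is_argmin_norm (A : set (dual H)) (xi : dual H) : Prop :=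
  A xi /\ forall eta, A eta -> dual_norm xi ^+ 2 <= dual_norm eta ^+ 2.

(* An execution, for arbitrary outcomes of the steps that compute some
   subderivative; every call of the bisection subroutine is required to return,
   but the execution itself may a priori go on forever. *)
Record dda_execution (Xi : nat -> set (dual H)) (xi : nat -> dual H)
    (v : nat -> H) (zeta : nat -> 'I_k -> dual H) : Prop := {
  dda_init : exists xi1 : 'I_k -> dual H,
    (forall i, goldstein_subdiff eps (f i) x (xi1 i)) /\ Xi 0%N = range xi1 ;
  dda_argmin : forall l, dda_reached xi l ->
    is_argmin_norm (-%R @` convex_hull (Xi l)) (xi l) ;
  dda_direction : forall l, dda_reached xi l -> v l = riesz_inv (xi l) ;
  dda_bisection : forall l j, dda_reached xi l.+1 ->
    violated_indices (v l) j ->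
    exists t, [/\ 0 < t <= eps / `|v l|,
      clarke_subdiff (f j) (x + t *: v l) (zeta l j),
      dual_inner (xi l) (zeta l j) > - c * dual_norm (xi l) ^+ 2 &
      bisection_returns (f j) x (xi l) eps c t (zeta l j)] ;
  dda_update : forall l, dda_reached xi l.+1 ->
    Xi l.+1 = Xi l `|` [set zeta l j | j in violated_indices (v l)]
}.

End DescentDirectionAlgorithm.

(* Main.v *)
From HB Require Import structures.
Require Import Defs.
From mathcomp Require Import all_boot all_order all_algebra.
From mathcomp Require Import all_classical all_reals all_analysis.
From mathcomp Require Import ring lra.

Set Implicit Arguments.
Unset Strict Implicit.
Unset Printing Implicit Defensive.

Import Order.TTheory GRing.Theory Num.Theory.
Import numFieldNormedType.Exports.

Local Open Scope classical_set_scope.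
Local Open Scope ring_scope.

(** Suppose that the algorithm never stops. The directions [v l] represent the
elements of minimal norm of the increasing convex sets [- conv (Xi l)], and the
minimality inequality gives [|v l - v m|^2 <= |v l|^2 - |v m|^2] for [l <= m].
As the norms decrease, [v] is a Cauchy sequence and converges in norm
([nested_argmin_cvg]).

This strong convergence replaces the compactness of balls, which fails in
infinite dimension: there a locally Lipschitz function need not be Lipschitz on
the ball of radius [eps], and its Goldstein subdifferential may be unbounded.
The trial points [x + t l *: v l], whose step lengths range in the compact
interval [[0, eps / delta]], nevertheless accumulate at some point [y]
([segment_steps_cluster]), and near [y] all subderivatives of all the [f i] are
bounded by one constant [L] ([locally_lipschitz_clarke_bounded]).

For infinitely many [l], a subderivative [zeta] returned by the bisection at
step [l] is therefore bounded by [L]. The test of the bisection reads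
[<v l, zeta> > - c |v l|^2], while minimality of [v l.+1], whose hull contains
[zeta], gives [<v l.+1, zeta> <= - |v l.+1|^2]
([argmin_norm_dual_inner_le]). Subtracting,
  [(1 - c) |v l.+1|^2 < L |v l - v l.+1| + c (|v l|^2 - |v l.+1|^2)].
The left-hand side stays above [(1 - c) delta^2] and the right-hand side tends
to 0, a contradiction.

The inner product of functionals is defined through [riesz_inv], so all these
computations rest on the Riesz representation theorem ([riesz_surj]), obtained
by minimizing [|u|^2 - 2 xi u]. *)

(** * Inner product *)

Section InnerProduct.
Context {R : realType} {H : hilbertType R}.
Implicit Types (u v w : H) (a : R).

Lemma innerDl u v w : inner (u + v) w = inner u w + inner v w.
Proof. by rewrite innerC innerDr !(innerC w). Qed.

Lemma innerZl a u v : inner (a *: u) v = a * inner u v.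
Proof. by rewrite innerC innerZr innerC. Qed.

Lemma innerNr u v : inner u (- v) = - inner u v.
Proof. by rewrite -scaleN1r innerZr mulN1r. Qed.

Lemma innerNl u v : inner (- u) v = - inner u v.
Proof. by rewrite innerC innerNr innerC. Qed.

Lemma inner_extr u v : (forall w, inner u w = inner v w) -> u = v.
Proof.
move=> uv; apply/subr0_eq/normr0_eq0/eqP; rewrite -sqrf_eq0 -inner_normE.
by rewrite innerDl innerNl uv subrr.
Qed.

Lemma sqr_normD u v : `|u + v| ^+ 2 = `|u| ^+ 2 + 2 * inner u v + `|v| ^+ 2.
Proof. by rewrite -!inner_normE innerDl !innerDr (innerC v u); ring. Qed.

Lemma sqr_normB u v : `|u - v| ^+ 2 = `|u| ^+ 2 - 2 * inner u v + `|v| ^+ 2.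
Proof. by rewrite sqr_normD innerNr normrN mulrN. Qed.

End InnerProduct.

(** * Two tools for minimization *)

(** First-order optimality along a segment starting at a minimizer: if [p] were
negative, the linear term would dominate for small [s]. *)
Lemma linear_part_ge0 (R : realFieldType) (p q : R) : 0 <= q ->
  (forall s, 0 < s <= 1 -> 0 <= 2 * s * p + s ^+ 2 * q) -> 0 <= p.
Proof.
move=> q0 pq; rewrite leNgt; apply/negP => p0.
have d0 : 0 < q - p by lra.
(* any s > 0 with s q < - 2 p works; this one is at most 1 even when q = 0 *)
pose s := - p / (q - p).
have s0 : 0 < s by rewrite divr_gt0// oppr_gt0.
have sq : s * (q - p) = - p by rewrite /s mulfVK// gt_eqF.
have s1 : s <= 1 by rewrite /s ler_pdivrMr//; lra.
have := pq s; rewrite s0 s1 => /(_ isT).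
have -> : 2 * s * p + s ^+ 2 * q = s * (2 * p + (s * (q - p) + s * p)) by ring.
rewrite sq pmulr_rge0//; have : s * p < 0 by rewrite pmulr_rlt0.
by lra.
Qed.

(** Both convexity arguments below control squared distances to all later terms,
which is the Cauchy property in the form that they deliver. *)
Lemma cvgn_sqr_norm_le (R : realType) (V : completeNormedModType R)
    (u : V ^nat) (b : R ^nat) : b @ \oo --> 0 ->
  (forall n m, (n <= m)%N -> `|u n - u m| ^+ 2 <= b n) -> cvgn u.
Proof.
move=> b0 ub; apply: cauchy_cvg; apply: cauchy_exP => e e0.
have /cvgrPdist_lt/(_ _ (exprn_gt0 2 e0))[N _ bN] := b0.
exists (u N); exists N => //= m Nm; rewrite -ball_normE /=.
rewrite -(@ltr_pXn2r _ 2)// ?nnegrE ?(ltW e0)//.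
apply: le_lt_trans (ub _ _ Nm) _; have := bN N (leqnn N).
by rewrite sub0r normrN; exact: le_lt_trans (ler_norm _).
Qed.

(** * Riesz representation *)

Section RieszRepresentation.
Context {R : realType} {H : hilbertType R}.
Implicit Types (u v w : H) (xi eta : dual H).

Lemma dual_linear xi : linear xi.
Proof. by have /asboolP[] := dualP xi. Qed.

Lemma dual_continuous xi : continuous xi.
Proof. by have /asboolP[] := dualP xi. Qed.

Lemma dualD xi u v : xi (u + v) = xi u + xi v.
Proof. by have := dual_linear xi 1 u v; rewrite !scale1r. Qed.

Lemma dual0 xi : xi 0 = 0.
Proof. by apply: (addrI (xi 0)); rewrite -dualD !addr0. Qed.

Lemma dualZ xi a u : xi (a *: u) = a * xi u.
Proof. by have := dual_linear xi a u 0; rewrite !addr0 dual0 addr0. Qed.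

Lemma dualN xi u : xi (- u) = - xi u.
Proof. by rewrite -scaleN1r dualZ mulN1r. Qed.

Lemma dual_bounded xi : exists2 M, 0 < M & forall u, `|xi u| <= M * `|u|.
Proof.
pose f : {linear H -> R^o} :=
  HB.pack (dual_fun xi) (GRing.isLinear.Build _ _ _ _ _ (dual_linear xi)).
have : bounded_near f (nbhs 0).
  by apply: continuous_linear_bounded; exact: dual_continuous.
by move=> /linear_boundedP /pinfty_ex_gt0.
Qed.

(** The functional [J u = |u|^2 - 2 xi u] is bounded below since [xi] is bounded,
and the parallelogram identity makes its minimizing sequences Cauchy. At the
minimizer [ul], optimality in the directions [w] and [- w] says that
[inner ul w = xi w]. *)
Lemma riesz_surj xi : exists u, riesz u = xi.
Proof.
pose J u : R := `|u| ^+ 2 - 2 * xi u.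
have J_D u w : J (u + w) = J u + 2 * (inner u w - xi w) + `|w| ^+ 2.
  by rewrite /J sqr_normD dualD; ring.
have [M M0 xiM] := dual_bounded xi.
have lbJ : has_inf (range J).
  split; first by exists (J 0), 0.
  exists (- M ^+ 2) => _ [u _ <-]; rewrite /J.
  have : xi u <= M * `|u| by exact: le_trans (ler_norm _) (xiM u).
  by have := sqr_ge0 (`|u| - M); nra.
have infJ u : inf (range J) <= J u by apply: ge_inf; [case: lbJ|exists u].
have /choice[u uJ] n : exists u, J u < inf (range J) + harmonic n.
  have [_ [u _ <-] uJ] := inf_adherent (harmonic_gt0 n) lbJ.
  by exists u.
have cu : cvgn u.
  apply: (@cvgn_sqr_norm_le _ _ _ (fun n => 4 * harmonic n)).
    by rewrite -(mulr0 4); apply: cvgM; [exact: cvg_cst|exact: cvg_harmonic].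
  move=> n m nm.
  have hm : harmonic m <= harmonic n :> R.
    by rewrite /= lef_pV2 ?posrE ?ltr0n// ler_nat.
  (* parallelogram identity at the midpoint *)
  have -> : `|u n - u m| ^+ 2 =
      2 * J (u n) + 2 * J (u m) - 4 * J (2^-1 *: (u n + u m)).
    rewrite /J normrZ exprMn sqr_normB sqr_normD dualZ dualD.
    by rewrite ger0_norm ?invr_ge0//; field.
  have := infJ (2^-1 *: (u n + u m)); have := uJ n; have := uJ m; move: hm.
  rewrite /harmonic /=.
  move: (J (u n)) (J (u m)) (J (2^-1 *: _)) (n.+1%:R^-1) (m.+1%:R^-1).
  by move=> *; lra.
pose ul := limn u.
have xicu : (xi (u n) : R) @[n --> \oo] --> (xi ul : R).
  by apply: (@cvg_comp _ _ _ u xi _ _ _ cu); exact: (@dual_continuous xi ul).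
have Jul w : J ul <= J w.
  apply: le_trans (infJ w).
  apply: (@ler_cvg_to _ \oo _ _ (J \o u) (fun n => inf (range J) + harmonic n)).
  - rewrite /J; apply: cvgB.
      by apply: cvgM; apply: cvg_norm; exact: cu.
    by apply: cvgM; [exact: cvg_cst|exact: xicu].
  - by rewrite -[X in _ --> X]addr0; apply: cvgD;
      [exact: cvg_cst|exact: cvg_harmonic].
  - by near=> n; exact/ltW/uJ.
have ge0 w : 0 <= inner ul w - xi w.
  apply: (linear_part_ge0 (sqr_ge0 `|w|)) => s _.
  have := Jul (ul + s *: w).
  rewrite J_D innerZr dualZ normrZ exprMn real_normK ?num_real//; lra.
exists ul; apply/val_inj/funext => w /=.
have := ge0 w; have := ge0 (- w).
rewrite innerNr dualN; lra.
Unshelve. all: by end_near.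
Qed.

Lemma rieszK : cancel (@riesz R H) riesz_inv.
Proof.
move=> u; rewrite /riesz_inv; case: xgetP => [v _ vu|/(_ u)/(_ erefl)[]].
by apply: inner_extr => w; exact: (congr1 (fun xi : dual H => xi w) vu).
Qed.

Lemma riesz_invK : cancel riesz_inv (@riesz R H).
Proof. by move=> xi; have [u <-] := riesz_surj xi; rewrite rieszK. Qed.

Lemma inner_riesz_inv xi u : inner (riesz_inv xi) u = xi u.
Proof. by rewrite -[in RHS](riesz_invK xi). Qed.

Lemma riesz_invD xi eta : riesz_inv (xi + eta) = riesz_inv xi + riesz_inv eta.
Proof. by apply: inner_extr => w; rewrite innerDl !inner_riesz_inv. Qed.

Lemma riesz_invZ a xi : riesz_inv (a *: xi) = a *: riesz_inv xi.
Proof. by apply: inner_extr => w; rewrite innerZl !inner_riesz_inv. Qed.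

Lemma riesz_invN xi : riesz_inv (- xi) = - riesz_inv xi.
Proof. by apply: inner_extr => w; rewrite innerNl !inner_riesz_inv. Qed.

Lemma dual_normE xi : dual_norm xi = `|riesz_inv xi|.
Proof. by rewrite /dual_norm /dual_inner inner_normE sqrtr_sqr normr_id. Qed.

End RieszRepresentation.

(** * Elements of minimal norm *)

Lemma convex_hull_conv (R : numDomainType) (E : lmodType R) (A : set E)
    (a b : E) (s : R) :
  0 <= s <= 1 -> convex_hull A a -> convex_hull A b ->
  convex_hull A (s *: a + (1 - s) *: b).
Proof.
move=> s01 Aa Ab B [cB AB].
have Ba : B a by exact: Aa.
have Bb : B b by exact: Ab.
case/andP: s01 => s0 s1; apply/set_mem.
exact: (cB a b (Itv01 s0 s1) (mem_set Ba) (mem_set Bb)).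
Qed.

Lemma convex_hull_mono (R : numDomainType) (E : lmodType R) (A B : set E) :
  A `<=` B -> convex_hull A `<=` convex_hull B.
Proof. by move=> AB a Aa C [cC BC]; apply: Aa; split=> // b /AB /BC. Qed.

Section MinimalNormElement.
Context {R : realType} {H : hilbertType R}.
Implicit Types (A : set (dual H)) (xi eta : dual H).

(** The variational inequality of the projection of 0 onto the convex set
[- conv A], tested at the point [- eta]. *)
Lemma argmin_norm_dual_inner_le A xi eta :
  is_argmin_norm (-%R @` convex_hull A) xi -> convex_hull A eta ->
  dual_inner xi eta <= - dual_norm xi ^+ 2.
Proof.
move=> [[rho Arho <-{xi}] xi_min] Aeta.
rewrite /dual_inner !dual_normE riesz_invN normrN innerNl lerN2 -subr_ge0.
set u := riesz_inv rho; set w := riesz_inv eta.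
have -> : inner u w - `|u| ^+ 2 = inner u (w - u).
  by rewrite innerDr innerNr inner_normE.
apply: (linear_part_ge0 (sqr_ge0 `|w - u|)) => s /andP[s0 s1].
have s01 : 0 <= s <= 1 by rewrite ltW.
have /xi_min : (-%R @` convex_hull A) (- (s *: eta + (1 - s) *: rho)).
  by exists (s *: eta + (1 - s) *: rho) => //; exact: convex_hull_conv.
rewrite !dual_normE !riesz_invN !normrN riesz_invD !riesz_invZ -/u -/w.
have -> : s *: w + (1 - s) *: u = u + s *: (w - u).
  by rewrite scalerBl scale1r scalerBr addrCA addrA.
rewrite sqr_normD innerZr normrZ exprMn real_normK ?num_real//; lra.
Qed.

(** The variational inequality at the later element [xi m], tested at [xi l],
gives [|xi l - xi m|^2 <= |xi l|^2 - |xi m|^2], and the squared norms decrease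
to a limit. *)
Lemma nested_argmin_cvg (A : nat -> set (dual H)) (xi : nat -> dual H) :
  (forall l, A l `<=` A l.+1) ->
  (forall l, is_argmin_norm (-%R @` convex_hull (A l)) (xi l)) ->
  cvgn (riesz_inv \o xi).
Proof.
move=> Asub xi_min.
have Amono l m : (l <= m)%N -> A l `<=` A m.
  elim: m => [|m IH]; first by rewrite leqn0 => /eqP ->.
  by rewrite leq_eqVlt => /predU1P[->//|/IH lm]; exact: subset_trans (Asub m).
pose u := riesz_inv \o xi.
have uB l m : (l <= m)%N -> `|u l - u m| ^+ 2 <= `|u l| ^+ 2 - `|u m| ^+ 2.
  move=> lm.
  have [rho Arho rhoE] := (xi_min l).1.
  have := argmin_norm_dual_inner_le (xi_min m)
    (convex_hull_mono (Amono _ _ lm) Arho).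
  rewrite dual_normE /dual_inner.
  have -> : rho = - xi l by rewrite -rhoE opprK.
  rewrite riesz_invN innerNr lerN2 innerC -/(u l) -/(u m) => h.
  by rewrite sqr_normB; move: h; rewrite /u /=; lra.
pose a n := `|u n| ^+ 2.
have a_noninc : nonincreasing_seq a.
  by move=> l m lm; rewrite -subr_ge0; apply: le_trans (uB _ _ lm).
have ca : cvgn a.
  apply: nonincreasing_is_cvgn => //.
  by exists 0 => _ [n _ <-]; exact: sqr_ge0.
apply: (@cvgn_sqr_norm_le _ _ _ (fun n => a n - limn a)).
  by rewrite -(subrr (limn a)); apply: cvgB; [exact: ca|exact: cvg_cst].
move=> n m nm; apply: le_trans (uB _ _ nm) _.
by rewrite lerB// nonincreasing_cvgn_ge.
Qed.

End MinimalNormElement.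

(** * Local boundedness of Clarke subderivatives *)

Section ClarkeBound.
Context {R : realType} {H : hilbertType R}.

(** The difference quotients defining the generalized derivative in the
direction [v] are at most [L * |v|]; the bound on the norm follows by taking for
[v] the vector that represents [zeta]. *)
Lemma clarke_subdiff_norm_le (g : H -> R) (y : H) (U : set H) (L : R)
    (zeta : dual H) : 0 <= L -> nbhs y U ->
  (forall a b, U a -> U b -> `|g a - g b| <= L * `|a - b|) ->
  clarke_subdiff g y zeta -> dual_norm zeta <= L.
Proof.
move=> L0 yU gL gzeta; rewrite dual_normE; set v := riesz_inv zeta.
have [->|v0] := eqVneq v 0; first by rewrite normr0.
suff : zeta v <= L * `|v|.
  by rewrite -inner_riesz_inv inner_normE expr2 ler_pM2r// normr_gt0.
rewrite -lee_fin; apply: le_trans (gzeta v) _.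
rewrite /generalized_derivative limf_esupE; apply: ge_ereal_inf.
have UD : filter_prod (nbhs y) (0^'+ : set_system R)
    [set p | [/\ U p.1, U (p.1 + p.2 *: v) & 0 < p.2]].
  have : (p.1 + p.2 *: v) @[p --> (y, 0 : R)] --> y.
    rewrite -[X in _ --> X]addr0 -(scale0r v).
    apply: cvgD; first exact: cvg_fst.
    by apply: cvgZr_tmp; exact: cvg_snd.
  move=> /(_ _ yU)[[B C] /= [nB nC] BCU].
  exists (B `&` U, C `&` [set t | 0 < t]) => [|[z t] /= [[Bz Uz] [Ct t0]]].
    split; first exact: filterI.
    by apply: filterI; [exact: (cvg_within _ nC)|exact: nbhs_right_gt].
  by split => //; exact: (BCU (z, t)).
eexists; first by exists [set p | [/\ U p.1, U (p.1 + p.2 *: v) & 0 < p.2]].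
apply: ge_ereal_sup => _ [[z t] /= [Uz Uzt t0] <-].
rewrite lee_fin ler_pdivrMr//; apply: le_trans (ler_norm _) _.
apply: le_trans (gL _ _ Uzt Uz) _.
by rewrite addrAC subrr add0r normrZ gtr0_norm// mulrA mulrAC.
Qed.

Lemma locally_lipschitz_clarke_bounded (g : H -> R) (y : H) :
  locally_lipschitz g ->
  \forall L \near +oo, \forall z \near y,
    forall zeta, clarke_subdiff g z zeta -> dual_norm zeta <= L.
Proof.
move=> /(_ y)[U yU gU]; near=> L.
have LU : L.-lipschitz_U (g : H -> R^o) by near: L; exact: gU.
have L0 : 0 <= L by near: L; exact: nbhs_pinfty_ge.
near=> z; move=> zeta; apply: (@clarke_subdiff_norm_le g z U L zeta) => //.
  by near: z; exact: nbhs_interior.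
by move=> a b Ua Ub; exact: (LU (a, b)).
Unshelve. all: by end_near. Qed.

End ClarkeBound.

(** * Termination *)

(** Compactness is available for the step lengths only; the convergence of the
directions transfers an accumulation point of [t] to the trial points. The
predicate [P] lets the index be chosen beyond any given rank. *)
Lemma segment_steps_cluster (R : realType) (V : normedModType R) (x u0 : V)
    (u : V ^nat) (t : R ^nat) (T : R) :
  u @ \oo --> u0 -> (forall n, 0 <= t n <= T) ->
  exists y : V, forall (U : set V) (P : set nat), nbhs y U ->
    (\forall n \near \oo, P n) ->
    exists2 n, P n & U (x + t n *: u n).
Proof.
move=> uu0 t0T.
have [|t0 [_ t0cl]] := @segment_compact R 0 T (t @ \oo) _.
  by exists 0%N => // n _; rewrite /= in_itv/=.
exists (x + t0 *: u0) => U P yU ooP.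
have [[B C] /= [nB nC] BCU] :
    nbhs (t0, u0) [set p : R * V | U (x + p.1 *: p.2)].
  have : (x + p.1 *: p.2) @[p --> (t0, u0)] --> x + t0 *: u0.
    by apply: cvgD; [exact: cvg_cst|exact: (@scale_continuous R V (t0, u0))].
  exact.
have uC : \forall n \near \oo, C (u n) by exact: uu0.
have [] := t0cl (t @` [set n | P n /\ C (u n)]) B _ nB.
  apply: (filterS _ (filterI ooP uC)) => n PCn; by exists n.
move=> _ [[n [Pn Cn] <-] Bn].
by exists n => //; exact: (BCU (t n, u n)).
Unshelve. all: by end_near. Qed.

(** At an index where the bisection returns a subderivative of norm at most [L]
and [gap l] is small, the stopping test of the bisection contradicts the
optimality of the next element. *)
Lemma dda_not_infinite (R : realType) (H : hilbertType R) (k : nat)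
    (f : 'I_k -> H -> R) (x : H) (eps delta c : R)
    (Xi : nat -> set (dual H)) (xi : nat -> dual H) (v : nat -> H)
    (zeta : nat -> 'I_k -> dual H) :
  (forall i, locally_lipschitz (f i)) ->
  0 < eps -> 0 < delta -> 0 < c < 1 ->
  dda_execution f x eps delta c Xi xi v zeta ->
  ~ (forall l, ~ dda_stop f x eps delta c (xi l)).
Proof.
move=> f_lip eps0 delta0 /andP[c0 c1] exec nonstop.
have reached l : dda_reached f x eps delta c xi l by move=> m _; exact: nonstop.
have vE l : v l = riesz_inv (xi l) by exact: dda_direction exec _ (reached l).
have v_gt l : delta < `|v l|.
  have /not_orP[/negP] := nonstop l; rewrite -ltNge dual_normE.
  by rewrite vE.
have v_gt0 l : 0 < `|v l| by exact: lt_trans (v_gt l).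
have Xi_sub l : Xi l `<=` Xi l.+1.
  by rewrite (dda_update exec (reached l.+1)); exact: subsetUl.
have xi_min l := dda_argmin exec (reached l).
have /cvg_ex[v0 vv0] := nested_argmin_cvg Xi_sub xi_min.
have {}vv0 : v @ \oo --> v0.
  by rewrite (_ : v = riesz_inv \o xi)//; apply/funext => l; exact: vE.
have /choice[j jP] l : exists j, violated_indices f x eps c (v l) j.
  have /not_orP[_ /eqP/set0P] := nonstop l.
  by rewrite -vE.
have /choice[t tP] l := dda_bisection exec (reached l.+1) (jP l).
have tT l : 0 <= t l <= eps / delta.
  have [/andP[t0 te] _ _ _] := tP l.
  rewrite ltW//=; apply: le_trans te _.
  by rewrite ler_pM2l// lef_pV2 ?posrE// ltW.
have [y yP] := segment_steps_cluster x vv0 tT.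
have [L L0 zL] : exists2 L, 0 < L & forall i, \forall z \near y,
    forall xi', clarke_subdiff (f i) z xi' -> dual_norm xi' <= L.
  apply: pinfty_ex_gt0; apply: filter_forall => i.
  exact: locally_lipschitz_clarke_bounded.
have {}zL : \forall z \near y, forall i,
    forall xi', clarke_subdiff (f i) z xi' -> dual_norm xi' <= L.
  exact: filter_forall zL.
(* upper bound for (1 - c) |v l.+1|^2 when the subderivative has norm <= L *)
pose gap l := L * `|v l - v l.+1| + c * (`|v l| ^+ 2 - `|v l.+1| ^+ 2).
have gap0 : gap @ \oo --> 0.
  have vS : v n.+1 @[n --> \oo] --> v0 by rewrite cvg_shiftS.
  have -> : 0 = L * `|v0 - v0| + c * (`|v0| ^+ 2 - `|v0| ^+ 2) :> R.
    by rewrite !subrr normr0 !mulr0 addr0.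
  apply: cvgD; apply: cvgM; try exact: cvg_cst.
    by apply: cvg_norm; exact: cvgB.
  by apply: cvgB; apply: cvgM; exact: cvg_norm.
have gap_small : \forall l \near \oo, gap l < (1 - c) * delta ^+ 2.
  have e0 : 0 < (1 - c) * delta ^+ 2 by rewrite mulr_gt0 ?exprn_gt0 ?subr_gt0.
  move/cvgrPdist_lt : gap0 => /(_ _ e0); apply: filterS => l.
  by rewrite sub0r normrN; exact: le_lt_trans (ler_norm _).
have [l gapl zl] := yP _ _ zL gap_small.
have [_ zetaP zeta_gt _] := tP l.
have zetaL := zl _ _ zetaP.
have Azeta : convex_hull (Xi l.+1) (zeta l (j l)).
  apply: sub_gen_smallest; rewrite (dda_update exec (reached l.+1)).
  by right; exists (j l).
have := argmin_norm_dual_inner_le (xi_min l.+1) Azeta.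
move: zeta_gt zetaL; rewrite /dual_inner !dual_normE -!vE.
set z := riesz_inv _ => zeta_gt zL' zeta_le.
have := inner_CauchySchwarz (v l - v l.+1) z.
have : `|v l - v l.+1| * `|z| <= L * `|v l - v l.+1|.
  by rewrite mulrC ler_wpM2r.
have := ler_norm (inner (v l - v l.+1) z).
rewrite innerDl innerNl.
have : delta ^+ 2 <= `|v l.+1| ^+ 2.
  by rewrite ler_pXn2r ?nnegrE ?ltW// v_gt.
have : 0 < 1 - c by rewrite subr_gt0.
move: gapl; rewrite /gap; nra.
Qed.

Theorem theorem4p8 (R : realType) (H : hilbertType R) (k : nat)
    (f : 'I_k -> H -> R) (x : H) (eps delta c : R)
    (Xi : nat -> set (dual H)) (xi : nat -> dual H) (v : nat -> H)
    (zeta : nat -> 'I_k -> dual H)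
    (f_lip : forall i, locally_lipschitz (f i))
    (eps_gt0 : 0 < eps) (delta_gt0 : 0 < delta) (c01 : 0 < c < 1)
    (exec : dda_execution f x eps delta c Xi xi v zeta) :
  (exists N, dda_terminates_at f x eps delta c xi N) /\
  (forall N, dda_terminates_at f x eps delta c xi N ->
    dual_norm (riesz (v N)) <= delta \/
    forall i, f i (x + (eps / `|v N|) *: v N) <= f i x - c * eps * `|v N|).
Proof.
split; last first.
  move=> N [reachedN stopN]; rewrite (dda_direction exec reachedN) riesz_invK.
  case: stopN => [|noviol]; [by left|right => i].
  rewrite leNgt; apply/negP => viol.
  suff : set0 i by [].
  by rewrite -noviol.
have /existsNP[n /contrapT stopn] :=
  dda_not_infinite f_lip eps_gt0 delta_gt0 c01 exec.
have exP : exists n, `[< dda_stop f x eps delta c (xi n) >].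
  by exists n; exact/asboolP.
case: (ex_minnP exP) => N /asboolP stopN Nmin.
exists N; split => // m mN /asboolP /Nmin.
by rewrite leqNgt mN.
Qed.
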